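(* For every voltage graph $(G,\Gamma,\alpha)$, the voltage graph $LR(G,\Gamma,\alpha)$ is isomorphic, in the category $\mathbf{Volt}$ of voltage graphs, to the voltage graph lift $(G^\alpha,\Gamma,\alpha')$ of $(G,\Gamma,\alpha)$.
   Context: A graph is a quintuple $G=(V,D,s,t,\lambda)$ where $V=V(G)$ is a set (vertices), $D=D(G)$ is a set (darts), $s,t\colon D\to V$ are maps (source and target), and $\lambda\colon D\to D$ is a map with $\lambda\circ\lambda=\mathrm{id}_D$ and $s\circ\lambda=t$. A morphism of graphs $f\colon G\to H$ is a pair of maps $f^V\colon V(G)\to V(H)$, $f^D\colon D(G)\to D(H)$ commuting with $s$, $t$ and $\lambda$. $\mathbf{Lab}$ (group labeled graphs): objects are triples $(G,\Gamma,\beta)$ with $G$ a graph, $\Gamma$ a group, $\beta\colon V(G)\to\Gamma$ a map; morphisms $(G,\Gamma,\beta)\to(G',\Gamma',\beta')$ are pairs $(f,h)$ with $f\colon G\to G'$ a graph morphism and $h\colon\Gamma\to\Gamma'$ a group homomorphism such that $h(\beta(v))=\beta'(f^V(v))$ for all $v\in V(G)$. $\mathbf{Volt}$ (voltage graphs): objects are triples $(G,\Gamma,\alpha)$ with $G$ a graph, $\Gamma$ a group, $\alpha\colon D(G)\to\Gamma$ a map with $\alpha(\lambda(d))=\alpha(d)^{-1}$; morphisms $(G,\Gamma,\alpha)\to(G',\Gamma',\alpha')$ are pairs $(f,h)$ with $f\colon G\to G'$ a graph morphism and $h\colon\Gamma\to\Gamma'$ a group homomorphism such that $h(\alpha(d))=\alpha'(f^D(d))$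 for all $d\in D(G)$. Composition in both categories is componentwise. For a group $\Gamma$: $\mathring{K}(\Gamma)$ is the graph with vertex set $\Gamma$, dart set $\Gamma\times\Gamma$, $s(x_1,x_2)=x_1$, $t(x_1,x_2)=x_2$, $\lambda(x_1,x_2)=(x_2,x_1)$; $\ell(\Gamma)$ is the graph with a single vertex, dart set $\Gamma$ and $\lambda(a)=a^{-1}$; $q_\Gamma\colon\mathring{K}(\Gamma)\to\ell(\Gamma)$ is the graph morphism given on darts by $q_\Gamma^D(u,v)=u^{-1}v$. A labeling $\beta\colon V(G)\to\Gamma$ is identified with the corresponding graph morphism $G\to\mathring{K}(\Gamma)$, and a voltage $\alpha\colon D(G)\to\Gamma$ with the corresponding graph morphism $G\to\ell(\Gamma)$. The functor $L\colon\mathbf{Lab}\to\mathbf{Volt}$ is $L(G,\Gamma,\beta)=(G,\Gamma,q_\Gamma\circ\beta)$, i.e. the voltage of $d$ is $\beta(s(d))^{-1}\beta(t(d))$, and $L(f,h)=(f,h)$. The functor $R\colon\mathbf{Volt}\to\mathbf{Lab}$ (right adjoint to $L$) is given on objects by $R(G,\Gamma,\alpha)=(G\times_{\ell(\Gamma)}\mathring{K}(\Gamma),\Gamma,q_\Gamma^*(\alpha))$, where $G\times_{\ell(\Gamma)}\mathring{K}(\Gamma)$ is the pullback, in the category of graphs, of $\alpha\colon G\to\ell(\Gamma)$ and $q_\Gamma\colon\mathring{K}(\Gamma)\to\ell(\Gamma)$ (computed as the pullback of sets on vertices and on darts, with componentwise structure maps $s,t,\lambda$), and $q_\Gamma^*(\alpha)$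 is the projection of this pullback to $\mathring{K}(\Gamma)$. The voltage graph lift of $(G,\Gamma,\alpha)$ is the voltage graph $(G^\alpha,\Gamma,\alpha')$ with $V(G^\alpha)=V(G)\times\Gamma$, $D(G^\alpha)=D(G)\times\Gamma$, $s(d,x)=(s(d),x)$, $t(d,x)=(t(d),x\alpha(d))$, $\lambda(d,x)=(\lambda(d),x\alpha(d))$, $\alpha'(d,x)=\alpha(d)$. *)

(* Defs.v *)
From HB Require Import structures.
From mathcomp Require Import all_boot.
From mathcomp Require Import boolp.

Set Implicit Arguments.
Unset Strict Implicit.
Unset Printing Implicit Defensive.

Local Open Scope group_scope.

Record graph := Graph {
  vertex : Type;
  dart : Type;
  src : dart -> vertex;
  tgt : dart -> vertex;
  inv_dart : dart -> dart;
  inv_dartK : forall d, inv_dart (inv_dart d) = d;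
  src_inv_dart : forall d, src (inv_dart d) = tgt d
}.

Record graph_mor (G H : graph) := GraphMor {
  vmap : vertex G -> vertex H;
  dmap : dart G -> dart H;
  dmap_src : forall d, src (dmap d) = vmap (src d);
  dmap_tgt : forall d, tgt (dmap d) = vmap (tgt d);
  dmap_inv : forall d, dmap (inv_dart d) = inv_dart (dmap d)
}.

Lemma tgt_inv_dart (G : graph) (d : dart G) : tgt (inv_dart d) = src d.
Proof. by rewrite -src_inv_dart inv_dartK. Qed.

Definition graph_id (G : graph) : graph_mor G G :=
  @GraphMor G G id id
    (fun=> erefl) (fun=> erefl) (fun=> erefl).

Section GraphComp.
Variables (G H K : graph) (g : graph_mor H K) (f : graph_mor G H).

Fact graph_comp_src d : src (dmap g (dmap f d)) = vmap g (vmap f (src d)).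
Proof. by rewrite !dmap_src. Qed.

Fact graph_comp_tgt d : tgt (dmap g (dmap f d)) = vmap g (vmap f (tgt d)).
Proof. by rewrite !dmap_tgt. Qed.

Fact graph_comp_inv d :
  dmap g (dmap f (inv_dart d)) = inv_dart (dmap g (dmap f d)).
Proof. by rewrite !dmap_inv. Qed.

Definition graph_comp : graph_mor G K :=
  @GraphMor G K (vmap g \o vmap f) (dmap g \o dmap f)
    graph_comp_src graph_comp_tgt graph_comp_inv.

End GraphComp.

Section GraphPullback.
Variables (G H K : graph) (f : graph_mor G K) (g : graph_mor H K).

Definition pb_vertex := {p : vertex G * vertex H | vmap f p.1 = vmap g p.2}.
Definition pb_dart := {p : dart G * dart H | dmap f p.1 = dmap g p.2}.

Fact pb_src_subproof (p : pb_dart) :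
  vmap f (src (sval p).1) = vmap g (src (sval p).2).
Proof. by rewrite -!dmap_src (svalP p). Qed.

Fact pb_tgt_subproof (p : pb_dart) :
  vmap f (tgt (sval p).1) = vmap g (tgt (sval p).2).
Proof. by rewrite -!dmap_tgt (svalP p). Qed.

Fact pb_inv_subproof (p : pb_dart) :
  dmap f (inv_dart (sval p).1) = dmap g (inv_dart (sval p).2).
Proof. by rewrite !dmap_inv (svalP p). Qed.

Definition pb_src (p : pb_dart) : pb_vertex :=
  exist _ (src (sval p).1, src (sval p).2) (pb_src_subproof p).

Definition pb_tgt (p : pb_dart) : pb_vertex :=
  exist _ (tgt (sval p).1, tgt (sval p).2) (pb_tgt_subproof p).

Definition pb_inv (p : pb_dart) : pb_dart :=
  exist _ (inv_dart (sval p).1, inv_dart (sval p).2) (pb_inv_subproof p).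

Fact pb_invK p : pb_inv (pb_inv p) = p.
Proof. by case: p => -[d e] de; apply: eq_exist; rewrite /= !inv_dartK. Qed.

Fact pb_src_inv p : pb_src (pb_inv p) = pb_tgt p.
Proof. by apply: eq_exist; rewrite /= !src_inv_dart. Qed.

Definition pullback : graph := Graph pb_invK pb_src_inv.

Definition pullback_snd : graph_mor pullback H :=
  @GraphMor pullback H (fun p => (sval p).2) (fun p => (sval p).2)
    (fun=> erefl) (fun=> erefl) (fun=> erefl).

End GraphPullback.

(* [groupType] covers arbitrary, possibly infinite, groups: the choice
   operator it bundles exists on every type by the axioms of [boolp], and it
   is not preserved by morphisms. *)
Notation group_hom := UMagmaMorphism.type.

Section GroupGraphs.
Variable Gamma : groupType.

(* $\mathring{K}(\Gamma)$ *)
Definition complete_graph : graph :=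
  @Graph Gamma (Gamma * Gamma)%type fst snd (fun p => (p.2, p.1))
    (fun p => esym (surjective_pairing p)) (fun=> erefl).

(* $\ell(\Gamma)$ *)
Definition loop_graph : graph :=
  @Graph unit Gamma (fun=> tt) (fun=> tt) (fun a => a^-1)
    (@invgK Gamma) (fun=> erefl).

Fact quot_mor_inv (p : Gamma * Gamma) : p.2^-1 * p.1 = (p.1^-1 * p.2)^-1.
Proof. by rewrite invgM invgK. Qed.

(* $q_\Gamma$ *)
Definition quot_mor : graph_mor complete_graph loop_graph :=
  @GraphMor complete_graph loop_graph (fun=> tt) (fun p => p.1^-1 * p.2)
    (fun=> erefl) (fun=> erefl) quot_mor_inv.

Definition labeling_mor (G : graph) (b : vertex G -> Gamma) :
    graph_mor G complete_graph :=
  @GraphMor G complete_graph b (fun d => (b (src d), b (tgt d)))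
    (fun=> erefl) (fun=> erefl)
    (fun d => congr2 (fun v w => (b v, b w))
                (src_inv_dart d) (tgt_inv_dart d)).

Definition mor_labeling (G : graph) (f : graph_mor G complete_graph) :
  vertex G -> Gamma := vmap f.

Definition voltage_mor (G : graph) (a : dart G -> Gamma)
    (aV : forall d, a (inv_dart d) = (a d)^-1) : graph_mor G loop_graph :=
  @GraphMor G loop_graph (fun=> tt) a (fun=> erefl) (fun=> erefl) aV.

Definition mor_voltage (G : graph) (f : graph_mor G loop_graph) :
  dart G -> Gamma := dmap f.

End GroupGraphs.

Record lab := Lab {
  lab_graph : graph;
  lab_group : groupType;
  labeling : vertex lab_graph -> lab_group
}.

Record volt := Volt {
  volt_graph : graph;
  volt_group : groupType;
  voltage : dart volt_graph -> volt_group;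
  voltageV : forall d, voltage (inv_dart d) = (voltage d)^-1
}.

Record volt_mor (X Y : volt) := VoltMor {
  volt_gmor : graph_mor (volt_graph X) (volt_graph Y);
  volt_hom : group_hom (volt_group X) (volt_group Y);
  volt_homE : forall d, volt_hom (voltage d) = voltage (dmap volt_gmor d)
}.

Definition volt_id (X : volt) : volt_mor X X :=
  @VoltMor X X (graph_id _) idfun (fun=> erefl).

Section VoltComp.
Variables (X Y Z : volt) (g : volt_mor Y Z) (f : volt_mor X Y).

Fact volt_comp_homE d :
  volt_hom g (volt_hom f (voltage d)) =
  voltage (dmap (volt_gmor g) (dmap (volt_gmor f) d)).
Proof. by rewrite !volt_homE. Qed.

Definition volt_comp : volt_mor X Z :=
  @VoltMor X Z (graph_comp (volt_gmor g) (volt_gmor f))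
    (volt_hom g \o volt_hom f) volt_comp_homE.

End VoltComp.

Definition volt_isomorphic (X Y : volt) : Prop :=
  exists (f : volt_mor X Y) (g : volt_mor Y X),
    volt_comp g f = volt_id X /\ volt_comp f g = volt_id Y.

(* Object parts of the functors $L$ and $R$. *)

Definition functorL (X : lab) : volt :=
  let qb := graph_comp (quot_mor (lab_group X)) (labeling_mor (@labeling X)) in
  @Volt (lab_graph X) (lab_group X) (mor_voltage qb) (dmap_inv qb).

Definition functorR (X : volt) : lab :=
  let a := voltage_mor (@voltageV X) in
  let q := quot_mor (volt_group X) in
  @Lab (pullback a q) (volt_group X) (mor_labeling (pullback_snd a q)).

Section Lift.
Variable X : volt.
Let G := volt_graph X.
Let Gamma := volt_group X.

Definition lift_inv (p : dart G * Gamma) : dart G * Gamma :=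
  (inv_dart p.1, p.2 * voltage p.1).

Fact lift_invK p : lift_inv (lift_inv p) = p.
Proof. by case: p => d x; rewrite /lift_inv /= inv_dartK voltageV mulgK. Qed.

Fact lift_src_inv (p : dart G * Gamma) :
  (src (inv_dart p.1), p.2 * voltage p.1) = (tgt p.1, p.2 * voltage p.1).
Proof. by rewrite src_inv_dart. Qed.

Definition lift_graph : graph :=
  @Graph (vertex G * Gamma)%type (dart G * Gamma)%type
    (fun p => (src p.1, p.2)) (fun p => (tgt p.1, p.2 * voltage p.1))
    lift_inv lift_invK lift_src_inv.

Definition lift : volt :=
  @Volt lift_graph Gamma (fun p => voltage p.1) (fun p => voltageV p.1).

End Lift.

(* Main.v *)
From mathcomp Require Import all_boot.
From mathcomp Require Import boolp.
Require Import Defs.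

Set Implicit Arguments.
Unset Strict Implicit.
Unset Printing Implicit Defensive.

(** A dart of the pullback is a triple [(d, x, y)] with [voltage d = x^-1 * y],
    so [y = x * voltage d] is determined by [(d, x)]: forgetting [y] identifies
    the pullback with the lift. *)

Local Open Scope group_scope.

(** Since $\ell(\Gamma)$ has a single vertex, the pullback condition on vertices is vacuous, leaving
    $V(G)\times\Gamma$. On darts, $\alpha(d)=x^{-1}y$ has the unique solution $y=x\alpha(d)$
    ([pullback_tgtE]), which turns the target and reversal of the pullback into those of the lift.
    The same equation says that the voltages agree, so both mutually inverse maps are taken with the
    identity on $\Gamma$. *)

Lemma graph_mor_eq (G H : graph) (f g : graph_mor G H) :
  vmap f =1 vmap g -> dmap f =1 dmap g -> f = g.
Proof.
case: f g => [fv fd fs ft fi] [gv gd gs gt gi] /= /funext ev /funext ed.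
case: gv / ev gs gt => gs gt; case: gd / ed gs gt gi => gs gt gi.
by rewrite (Prop_irrelevance fs gs) (Prop_irrelevance ft gt)
  (Prop_irrelevance fi gi).
Qed.

(** Apart from the underlying function, the bundled structure holds only propositions (compatibility
    with product and unit), so extensionality and proof irrelevance suffice. *)
Lemma group_hom_eq (G H : groupType) (f g : group_hom G H) : f =1 g -> f = g.
Proof.
case: f g => [f [[fM] [f1]]] [g [[gM] [g1]]] /= /funext fg.
case: g / fg gM g1 => gM g1.
by rewrite (Prop_irrelevance fM gM) (Prop_irrelevance f1 g1).
Qed.

(** Reduces the two inverse laws of the isomorphism to pointwise cancellations. *)
Lemma volt_mor_eq (X Y : volt) (f g : volt_mor X Y) :
  vmap (volt_gmor f) =1 vmap (volt_gmor g) ->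
  dmap (volt_gmor f) =1 dmap (volt_gmor g) ->
  volt_hom f =1 volt_hom g -> f = g.
Proof.
case: f g => [f h fh] [g k gk] /= ev ed /group_hom_eq eh.
have eg := graph_mor_eq ev ed; subst g k.
by rewrite (Prop_irrelevance fh gk).
Qed.

Section LiftIso.
Variable X : volt.
Let Gamma := volt_group X.
Let P := pullback (voltage_mor (@voltageV X)) (quot_mor Gamma).

Lemma pullback_tgtE (p : dart P) :
  (sval p).2.2 = (sval p).2.1 * voltage (sval p).1.
Proof. by case: p => -[d [x y]] /= ->; rewrite mulVKg. Qed.

Definition pullback_to_lift_vertex (p : vertex P) : vertex (lift_graph X) :=
  ((sval p).1, (sval p).2).

Definition pullback_to_lift_dart (p : dart P) : dart (lift_graph X) :=
  ((sval p).1, (sval p).2.1).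

Fact pullback_to_lift_tgt p :
  tgt (pullback_to_lift_dart p) = pullback_to_lift_vertex (tgt p).
Proof. by congr pair; rewrite /= pullback_tgtE. Qed.

(** Reversal swaps $x$ and $y$, so the coordinate kept afterwards is $y=x\alpha(d)$, as in the
    lift. *)
Fact pullback_to_lift_inv p :
  pullback_to_lift_dart (inv_dart p) = inv_dart (pullback_to_lift_dart p).
Proof. by congr pair; rewrite /= pullback_tgtE. Qed.

Definition pullback_to_lift : graph_mor P (lift_graph X) :=
  GraphMor (fun=> erefl) pullback_to_lift_tgt pullback_to_lift_inv.

Definition lift_to_pullback_vertex (p : vertex (lift_graph X)) : vertex P :=
  exist _ (p.1, p.2) erefl.

Definition lift_to_pullback_dart (p : dart (lift_graph X)) : dart P :=
  exist _ (p.1, (p.2, p.2 * voltage p.1)) (esym (mulKg p.2 (voltage p.1))).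

Fact lift_to_pullback_src p :
  src (lift_to_pullback_dart p) = lift_to_pullback_vertex (src p).
Proof. exact: eq_exist. Qed.

Fact lift_to_pullback_tgt p :
  tgt (lift_to_pullback_dart p) = lift_to_pullback_vertex (tgt p).
Proof. exact: eq_exist. Qed.

Fact lift_to_pullback_inv p :
  lift_to_pullback_dart (inv_dart p) = inv_dart (lift_to_pullback_dart p).
Proof. by apply: eq_exist; rewrite /= voltageV mulgK. Qed.

Definition lift_to_pullback : graph_mor (lift_graph X) P :=
  GraphMor lift_to_pullback_src lift_to_pullback_tgt lift_to_pullback_inv.

Lemma pullback_to_lift_vertexK :
  cancel pullback_to_lift_vertex lift_to_pullback_vertex.
Proof. by case=> -[v x] e; apply: eq_exist. Qed.

Lemma pullback_to_lift_dartK :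
  cancel pullback_to_lift_dart lift_to_pullback_dart.
Proof.
move=> p; have := pullback_tgtE p.
by case: p => -[d [x y]] /= e yE; apply: eq_exist; rewrite /= yE.
Qed.

Lemma lift_to_pullback_vertexK :
  cancel lift_to_pullback_vertex pullback_to_lift_vertex.
Proof. by case. Qed.

Lemma lift_to_pullback_dartK :
  cancel lift_to_pullback_dart pullback_to_lift_dart.
Proof. by case. Qed.

(** The left side computes to $x^{-1}y$, so this is the equation defining the pullback, read
    backwards. *)
Fact LR_to_lift_homE (d : dart P) :
  idfun (@voltage (functorL (functorR X)) d) =
  @voltage (lift X) (dmap pullback_to_lift d).
Proof. exact: esym (svalP d). Qed.

Definition LR_to_lift : volt_mor (functorL (functorR X)) (lift X) :=
  @VoltMor (functorL (functorR X)) (lift X) pullback_to_lift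
    (idfun : group_hom Gamma Gamma) LR_to_lift_homE.

Fact lift_to_LR_homE (d : dart (lift_graph X)) :
  idfun (@voltage (lift X) d) =
  @voltage (functorL (functorR X)) (dmap lift_to_pullback d).
Proof. exact: svalP (lift_to_pullback_dart d). Qed.

Definition lift_to_LR : volt_mor (lift X) (functorL (functorR X)) :=
  @VoltMor (lift X) (functorL (functorR X)) lift_to_pullback
    (idfun : group_hom Gamma Gamma) lift_to_LR_homE.

End LiftIso.

Theorem theorem3p5 (X : volt) : volt_isomorphic (functorL (functorR X)) (lift X).
Proof.
(* The group components compose to the identity by computation; only vertices and darts remain. *)
exists (LR_to_lift X), (lift_to_LR X); split; apply: volt_mor_eq => //.
- exact: pullback_to_lift_vertexK.
- exact: pullback_to_lift_dartK.
- exact: lift_to_pullback_vertexK.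
- exact: lift_to_pullback_dartK.
Qed.
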